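(* Let $k$ be an algebraically closed field of characteristic zero, and let $\varepsilon\in k^*$ have order $5$ and $\sqrt{-1}\in k$ be a square root of $-1$. Put $$c_1=-1,\quad c_2=1-\varepsilon^2+\varepsilon^4+\sqrt{-1}(-1-\varepsilon+\varepsilon^3),\quad c_3=-\varepsilon+\varepsilon^4+\sqrt{-1}(\varepsilon^2+\varepsilon^3),\quad c_4=-\varepsilon^3-\varepsilon^4-\sqrt{-1}(\varepsilon+\varepsilon^2),$$ $$C=\mathrm{diag}[1,\sqrt{-1},1,-1]\begin{bmatrix}c_1&c_2&c_3&c_4\\c_3&c_4&c_1&c_2\\c_4&c_1&c_2&c_3\\c_2&c_3&c_4&c_1\end{bmatrix},\qquad S=C\,\hat{\sigma}^2\,\mathrm{diag}[\varepsilon^4,\varepsilon^3,\varepsilon,\varepsilon^2]\in GL_4(k),$$ where $\sigma=(1234)$ and $\hat\sigma=[e_{\sigma(1)},e_{\sigma(2)},e_{\sigma(3)},e_{\sigma(4)}]$. Let $$M^{12}=x^4+y^4+z^4+t^4+12xyzt,\quad F_0=x^3y+y^3z+z^3t+t^3x+3xyzt,\quad F_1=x^2z^2+y^2t^2+2xyzt.$$ Then $$M^{12}_{S^{-1}}=80p\left\{F_0-\tfrac34(1+\sqrt{-1})F_1\right\},$$ where $p=3+20\varepsilon+28\varepsilon^2+16\varepsilon^3+\sqrt{-1}(17+20\varepsilon+4\varepsilon^2-8\varepsilon^3)$.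
   Context: For a polynomial $f\in k[x,y,z,t]$ and $A\in GL_4(k)$, $f_{A^{-1}}$ denotes the polynomial $v\mapsto f(Av)$, where $v=(x,y,z,t)^{T}$. $e_i$ is the $i$-th column of the unit matrix and $[v_1,\dots,v_4]$ denotes the matrix with columns $v_1,\dots,v_4$. *)

(* Defs.v *)
From HB Require Import structures.
From mathcomp Require Import all_boot all_order all_fingroup all_algebra.
From mathcomp Require Import mpoly.

Set Implicit Arguments.
Unset Strict Implicit.
Unset Printing Implicit Defensive.

Import GRing.Theory.
Local Open Scope ring_scope.

Section Substitution.
Variable R : comNzRingType.

(* f_{A^-1}, i.e. the polynomial v |-> f(A v): the i-th variable of f is
   replaced by the i-th coordinate of A v. *)
Definition mpoly_act_inv n (f : {mpoly R[n]}) (A : 'M[R]_n) : {mpoly R[n]} :=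
  f \mPo [tuple \sum_(j < n) A i j *: 'X_j | i < n].

(* [e_{s(1)}, ..., e_{s(n)}]: column j is the unit vector e_{s j}. This is the
   transpose of the library's perm_mx s. *)
Definition hat_mx n (s : 'S_n) : 'M[R]_n := \matrix_(i, j) (i == s j)%:R.

Definition mx4_of_rows (r : seq (seq R)) : 'M[R]_4 :=
  \matrix_(i, j) nth 0 (nth [::] r i) j.

Definition diag4 (a b c d : R) : 'M[R]_4 :=
  diag_mx (\row_j nth 0 [:: a; b; c; d] j).

End Substitution.

(* The 4-cycle (1 2 3 4), with indices shifted to 0, ..., 3. *)
Definition sigma4 : 'S_4 := perm (can_inj (@ordSK 4)).

Section Quartics.
Variable R : comNzRingType.

Let x : {mpoly R[4]} := 'X_(0 : 'I_4).
Let y : {mpoly R[4]} := 'X_(1 : 'I_4).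
Let z : {mpoly R[4]} := 'X_(2 : 'I_4).
Let t : {mpoly R[4]} := 'X_(3 : 'I_4).

Definition quartic_M12 : {mpoly R[4]} :=
  x ^+ 4 + y ^+ 4 + z ^+ 4 + t ^+ 4 + 12 * x * y * z * t.

Definition quartic_F0 : {mpoly R[4]} :=
  x ^+ 3 * y + y ^+ 3 * z + z ^+ 3 * t + t ^+ 3 * x + 3 * x * y * z * t.

Definition quartic_F1 : {mpoly R[4]} :=
  x ^+ 2 * z ^+ 2 + y ^+ 2 * t ^+ 2 + 2 * x * y * z * t.

End Quartics.

Arguments quartic_M12 : clear implicits.
Arguments quartic_F0 : clear implicits.
Arguments quartic_F1 : clear implicits.

(* I stands for the chosen square root of -1. *)
Section Matrices.
Variables (R : comNzRingType) (eps I : R).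

Definition c1 : R := -1.
Definition c2 : R := 1 - eps ^+ 2 + eps ^+ 4 + I * (-1 - eps + eps ^+ 3).
Definition c3 : R := - eps + eps ^+ 4 + I * (eps ^+ 2 + eps ^+ 3).
Definition c4 : R := - eps ^+ 3 - eps ^+ 4 - I * (eps + eps ^+ 2).

Definition mxC : 'M[R]_4 :=
  diag4 1 I 1 (-1) *m
  mx4_of_rows [:: [:: c1; c2; c3; c4];
                  [:: c3; c4; c1; c2];
                  [:: c4; c1; c2; c3];
                  [:: c2; c3; c4; c1]].

Definition mxS : 'M[R]_4 :=
  mxC *m hat_mx R sigma4 ^+ 2 *m diag4 (eps ^+ 4) (eps ^+ 3) eps (eps ^+ 2).

Definition coef_p : R :=
  3 + 20 * eps + 28 * eps ^+ 2 + 16 * eps ^+ 3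
  + I * (17 + 20 * eps + 4 * eps ^+ 2 - 8 * eps ^+ 3).

End Matrices.

(* Main.v *)
(* Both claims are identities in Z[eps, I] modulo
   1 + eps + eps^2 + eps^3 + eps^4 = 0 and I^2 = -1. For invertibility, let
   S' be the matrix obtained from S by the "complex conjugation" eps |-> eps^4,
   I |-> - I: up to a scalar S is unitary, i.e. S S'^T = lambda, and lambda
   divides 10. *)
Require Import Defs.
From mathcomp Require Import all_boot all_order all_fingroup all_algebra.
From mathcomp Require Import mpoly ring.

Import GRing.Theory.

Local Open Scope ring_scope.

(** Cancel the nonzero factor [eps - 1] from [eps ^+ 5 - 1 = 0]. Solved for [eps ^+ 4], the relation
    serves [ring] as a reduction rule. *)
Lemma prim5_expr4 (R : idomainType) (eps : R) :
  5.-primitive_root eps -> eps ^+ 4 = - (1 + eps + eps ^+ 2 + eps ^+ 3).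
Proof.
move=> eps5; have eps1 : eps - 1 != 0.
  by rewrite subr_eq0 -(prim_order_dvd eps5 1).
apply: (mulfI eps1); have := prim_expr_order eps5.
by move=> E; ring: E.
Qed.

(** Right multiplication by the squared 4-cycle moves the columns of [mxC] cyclically by two places;
    the two diagonal factors scale rows and columns. *)
Lemma mxSE (R : comNzRingType) (eps I : R) (i j : 'I_4) :
  mxS eps I i j =
    nth 0 [:: 1; I; 1; -1] i *
    nth 0 (nth [::] [:: [:: c3 eps I; c4 eps I; c1 R; c2 eps I];
                        [:: c1 R; c2 eps I; c3 eps I; c4 eps I];
                        [:: c2 eps I; c3 eps I; c4 eps I; c1 R];
                        [:: c4 eps I; c1 R; c2 eps I; c3 eps I]] i) j *
    nth 0 [:: eps ^+ 4; eps ^+ 3; eps; eps ^+ 2] j.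
Proof.
have hat2 : hat_mx R sigma4 ^+ 2 =
    \matrix_(l, m) (l == sigma4 (sigma4 m))%:R.
  apply/matrixP=> l m; rewrite expr2 !mxE (bigD1 (sigma4 m)) //= !mxE eqxx.
  rewrite mulr1 big1 ?addr0 // => h /negPf neq_h.
  by rewrite !mxE neq_h mulr0.
rewrite /mxS /mxC /diag4 mul_mx_diag mxE mul_diag_mx hat2 mxE.
rewrite (bigD1 (sigma4 (sigma4 j))) //= big1 => [|h /negPf neq_h]; last first.
  by rewrite !mxE neq_h mulr0.
rewrite addr0 !mxE eqxx mulr1 !permE /=.
by case: i j => [[|[|[|[|//]]]] ?] [[|[|[|[|//]]]] ?].
Qed.

Lemma mxS_unitary (R : comNzRingType) (eps I : R) :
    eps ^+ 4 = - (1 + eps + eps ^+ 2 + eps ^+ 3) -> I ^+ 2 = -1 ->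
  mxS eps I *m (mxS (eps ^+ 4) (- I))^T =
    (10 - 10 * eps ^+ 2 - 10 * eps ^+ 3
     - I * (8 + 16 * eps + 14 * eps ^+ 2 + 2 * eps ^+ 3))%:M.
Proof.
move=> eps4 sqI; apply/matrixP=> i j; rewrite mxE [RHS]mxE.
rewrite !big_ord_recl big_ord0 ![_^T _ _]mxE !mxSE /c1 /c2 /c3 /c4.
by case: i j => [[|[|[|[|//]]]] ?] [[|[|[|[|//]]]] ?] /=; ring: eps4 sqI.
Qed.

Lemma mxS_unit (R : comUnitRingType) (eps I : R) :
    eps ^+ 4 = - (1 + eps + eps ^+ 2 + eps ^+ 3) -> I ^+ 2 = -1 ->
  (10 : R) \is a GRing.unit -> mxS eps I \in unitmx.
Proof.
move=> eps4 sqI unit10.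
have := congr1 determinant (mxS_unitary _ _ _ eps4 sqI).
rewrite det_mulmx det_scalar => detS.
suff : \det (mxS eps I) * \det (mxS (eps ^+ 4) (- I))^T \is a GRing.unit.
  by rewrite unitrM unitmxE => /andP[].
rewrite detS unitrX //; set lambda := (X in X \is a _).
(* The cofactor is [10 / lambda] computed in the field generated by [eps] and [I] over the
   rationals; like [lambda], it is fixed by the conjugation. *)
have lambda_dvd10 :
    lambda * (3 + eps ^+ 2 + eps ^+ 3 + I * (eps ^+ 2 - eps ^+ 3)) = 10.
  by rewrite /lambda; ring: eps4 sqI.
by move: unit10; rewrite -lambda_dvd10 unitrM => /andP[].
Qed.

(** With 80 * 3/4 = 60 multiplied out, all coefficients are integral in [eps] and [I], so the
    identity makes sense over any commutative ring. *)
Lemma quartic_M12_mxS (R : comNzRingType) (eps I : R) :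
    eps ^+ 4 = - (1 + eps + eps ^+ 2 + eps ^+ 3) -> I ^+ 2 = -1 ->
  mpoly_act_inv (quartic_M12 R) (mxS eps I) =
    (80 * coef_p eps I) *: quartic_F0 R
    - (60 * coef_p eps I * (1 + I)) *: quartic_F1 R.
Proof.
(* The final [ring] call works in [{mpoly R[4]}], so both relations are restated for constant
   polynomials. *)
move=> /(congr1 (@mpolyC 4 R)) eps4 /(congr1 (@mpolyC 4 R)) sqI.
have {}eps4 : eps%:MP_[4] ^+ 4 =
    - (1 + eps%:MP + eps%:MP ^+ 2 + eps%:MP ^+ 3) by ring: eps4.
have {}sqI : I%:MP_[4] ^+ 2 = -1 by ring: sqI.
rewrite /mpoly_act_inv /quartic_M12 !(rmorphD, rmorphM, rmorphXn, rmorph_nat) /=.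
rewrite !comp_mpolyXU -!tnth_nth !tnth_mktuple !big_ord_recl !big_ord0 !mxSE /=.
rewrite -!mul_mpolyC /quartic_F0 /quartic_F1 /coef_p /c1 /c2 /c3 /c4.
by ring: eps4 sqI.
Qed.

Theorem theorem7p6 (k : closedFieldType) (char0 : [pchar k] =i pred0)
    (eps I : k) (eps_ord5 : 5.-primitive_root eps) (sqI : I ^+ 2 = -1) :
  mxS eps I \in unitmx /\
  mpoly_act_inv (quartic_M12 k) (mxS eps I) =
    (80 * coef_p eps I) *:
      (quartic_F0 k - (3 / 4 * (1 + I)) *: quartic_F1 k).
Proof.
have eps4 := prim5_expr4 _ _ eps_ord5.
(* Characteristic zero enters twice: 10 must be a unit for invertibility, and the denominator 4 must
   be nonzero. *)
have natr_neq0 n : n.+1%:R != 0 :> k by rewrite (proj1 (pcharf0P k) char0).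
split; first by apply: mxS_unit; rewrite ?unitfE ?natr_neq0.
rewrite quartic_M12_mxS // scalerBr scalerA; congr (_ - _ *: _).
by field; apply: natr_neq0.
Qed.
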